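(* For all non-negative integers $L$, positive integers $p,p'$ such that $p' > p$, and any integer $n\ge 2$, \[ D_{2^np',2^ns}\left(L+2^{n-2}+2^{n-1}(r-s),\,L-2^{n-2}-2^{n-1}(r-s);\,\frac{\frac{2^{2n}-1}{3}(2p'-1)-\frac{2^{2n+1}+1}{3}r+p}{2^n},\,\frac{\frac{2^{2n+1}+1}{3}r+\frac{2^{2n}-1}{3}}{2^n}\right) \ge 0, \] where $r$, $s$ are integers such that $0 < r < p$ and $0 < s < p'$.
   Context: The $q$-binomial coefficient is $\begin{bmatrix}m\\ n\end{bmatrix}_q=\frac{(q;q)_m}{(q;q)_n(q;q)_{m-n}}$ for $m\ge n\ge 0$ and $0$ otherwise, where $(a;q)_L=\prod_{k=0}^{L-1}(1-aq^k)$. For integers $K,i$ and (possibly rational) parameters $N,M,\alpha,\beta$, \[ D_{K,i}(N,M;\alpha,\beta)=\sum_{j\in\mathbb{Z}}\left\{q^{j((\alpha+\beta)Kj+K\beta-(\alpha+\beta)i)}\begin{bmatrix}M+N\\ M-Kj\end{bmatrix}_{q}-q^{((\alpha+\beta)j+\beta)(Kj+i)}\begin{bmatrix}M+N\\ M-Kj-i\end{bmatrix}_{q}\right\}. \] ''$P(q)\ge 0$'' means the power series $P(q)$ has non-negative coefficients. *)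

(* Defs.v *)
From mathcomp Require Import all_boot all_order all_algebra.
Set Implicit Arguments. Unset Strict Implicit. Unset Printing Implicit Defensive.
Import Order.TTheory GRing.Theory Num.Theory.
Local Open Scope ring_scope.

Definition qpoch (m : nat) : {poly rat} := \prod_(k < m) (1 - 'X^(k.+1)).

(* q-binomial [m; n]_q for integers m, n: (q;q)_m / ((q;q)_n (q;q)_(m-n))
   when m >= n >= 0 (the division is exact), and 0 otherwise. *)
Definition qbinom (m n : int) : {poly rat} :=
  if (0 <= n) && (n <= m) then
    qpoch `|m|%N %/ (qpoch `|n|%N * qpoch `|m - n|%N)
  else 0.

(* Coefficient of q^d (d rational) in the generalized power series q^e * P(q). *)
Definition shift_coef (e : rat) (P : {poly rat}) (d : rat) : rat :=
  let x := d - e in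
  if (denq x == 1) && (0 <= numq x) then P`_(`|numq x|%N) else 0.

(* Bound on |j| outside of which all summands of D vanish (when K <> 0):
   a nonzero term needs -N <= K j <= M or -N <= K j + i <= M. *)
Definition Dbound (K i N M : int) : nat := (`|M| + `|N| + `|i|)%N.

Definition De1 (K i : int) (a b : rat) (j : int) : rat :=
  j%:~R * ((a + b) * K%:~R * j%:~R + K%:~R * b - (a + b) * i%:~R).
Definition De2 (K i : int) (a b : rat) (j : int) : rat :=
  ((a + b) * j%:~R + b) * (K%:~R * j%:~R + i%:~R).

(* Coefficient of q^d in D_{K,i}(N,M;a,b) (sum over j in Z, which is a finite
   sum over |j| <= Dbound when K <> 0). *)
Definition Dcoef (K i N M : int) (a b : rat) (d : rat) : rat :=
  let B := Dbound K i N M in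
  \sum_(t < (B + B).+1)
    let j : int := t%:Z - B%:Z in
    (shift_coef (De1 K i a b j) (qbinom (M + N) (M - K * j)) d
     - shift_coef (De2 K i a b j) (qbinom (M + N) (M - K * j - i)) d).

Definition Dnonneg (K i N M : int) (a b : rat) : Prop :=
  forall d : rat, 0 <= Dcoef K i N M a b d.

(* Main.v *)
(** Put a = 2p'j + r - s (first family of terms) or a = 2p'j + r + s (second
family), and let b be a or -a-1, whichever is non-negative. Up to an overall power
of q, the j-th term at level n >= 2 is q^(e_j + (4^n-1)/3 b(b+1)/2) times
[2L; L + 2^(n-2)(2b+1)], where e_j does not depend on n. With kernels T_c(L,m)
having non-negative coefficients,
   q^(x(x+c)/2) sum_i q^(i(i+x+c)) [L;i][L;i+x]
     = sum_(m = x mod 2) T_c(L,m) [m; (m+x)/2],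
and by q-Vandermonde the left side is q^(x^2/2) [2L; L+x] for c = 0, while two
instances of c = 1 add up to q^(b(b+1)/2) [2L+1; L+1+b]. So positivity at level n+1 follows
from level n, at level 2 from that of the terms [2L+1; L+1+b], and for these from the
terms q^(e_j) [m; ceil((m+b)/2)]. The latter form the polynomial
D_(p',s)(N,M;p-r,r) with N + M = m and N - M in {r-s, r-s+1}, whose positivity
(Andrews-Baxter-Bressoud-Burge-Forrester-Viennot) follows from the two q-Pascal rules
by induction on m. *)
Require Import Defs.
From mathcomp Require Import all_boot all_order all_algebra.
From mathcomp Require Import zify ring.
Import Order.TTheory GRing.Theory Num.Theory.
Local Open Scope ring_scope.

(** * Gaussian polynomials: q-Pascal rules, q-Vandermonde, products *)

(** The recursive form avoids the division in [qbinom]; [qbinomE] identifies the two. *)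
Fixpoint gauss (n k : nat) : {poly rat} :=
  match n, k with
  | _, 0%N => 1
  | 0%N, _.+1 => 0
  | n'.+1, k'.+1 => gauss n' k' + 'X^(k'.+1) * gauss n' k'.+1
  end.

Lemma gauss_n0 n : gauss n 0 = 1. Proof. by case: n. Qed.

Lemma gaussS n k : gauss n.+1 k.+1 = gauss n k + 'X^(k.+1) * gauss n k.+1.
Proof. by []. Qed.

Lemma gauss_small n k : (n < k)%N -> gauss n k = 0.
Proof.
elim: n k => [|n IH] [|k] //= lt_nk.
by rewrite !IH ?mulr0 ?addr0 //; lia.
Qed.

Lemma qpochS m : qpoch m.+1 = qpoch m * (1 - 'X^(m.+1)).
Proof. by rewrite /qpoch big_ord_recr. Qed.

Lemma qpoch_neq0 m : qpoch m != 0.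
Proof.
rewrite /qpoch; apply/prodf_neq0 => k _.
rewrite subr_eq0; apply/eqP => /(congr1 (size \o @polyseq _)) /=.
by rewrite size_poly1 size_polyXn.
Qed.

Lemma gauss_qpoch n k : (k <= n)%N ->
  gauss n k * (qpoch k * qpoch (n - k)) = qpoch n.
Proof.
have qpoch0 : qpoch 0 = 1 by rewrite /qpoch big_ord0.
elim: n k => [|n IH] [|k] //= le_kn; rewrite ?qpoch0 ?mul1r ?subn0 //.
move: le_kn; rewrite ltnS leq_eqVlt => /predU1P[->|lt_kn].
  by rewrite (gauss_small n n.+1) // mulr0 addr0 subnn qpochS -[in RHS](IH n) // subnn; ring.
have -> : (n.+1 - k.+1 = (n - k.+1).+1)%N by lia.
have e1 := IH k (ltnW lt_kn); have e2 := IH k.+1 lt_kn.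
have E : (n - k = (n - k.+1).+1)%N by lia.
rewrite E in e1; rewrite !qpochS in e1 e2 *.
transitivity (gauss n k * (qpoch k * (qpoch (n - k.+1) * (1 - 'X^((n - k.+1).+1))))
   * (1 - 'X^(k.+1)) + 'X^(k.+1) * (gauss n k.+1 *
   (qpoch k * (1 - 'X^(k.+1)) * qpoch (n - k.+1))) * (1 - 'X^((n - k.+1).+1))); first by ring.
rewrite e1 e2; have -> : 'X^(n.+1) = 'X^(k.+1) * 'X^((n - k.+1).+1) :> {poly rat}
  by rewrite -exprD; congr (_ ^+ _); lia.
by ring.
Qed.

Lemma gauss_sym n k : (k <= n)%N -> gauss n (n - k) = gauss n k.
Proof.
move=> le_kn; apply: (@mulIf _ (qpoch k * qpoch (n - k))).
  by rewrite mulf_neq0 ?qpoch_neq0.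
rewrite gauss_qpoch // [qpoch k * _]mulrC -[in qpoch k](subKn le_kn).
by rewrite gauss_qpoch // leq_subr.
Qed.

(** The other q-Pascal rule, which is [gaussS] conjugated by the symmetry k -> n - k. *)
Lemma gaussS_dual n k : (k <= n)%N ->
  gauss n.+1 k.+1 = gauss n k.+1 + 'X^(n - k) * gauss n k.
Proof.
rewrite leq_eqVlt => /predU1P[->|lt_kn].
  by rewrite gaussS subnn (gauss_small n n.+1) //; ring.
rewrite -gauss_sym; last by lia.
have -> : (n.+1 - k.+1 = (n - k.+1).+1)%N by lia.
rewrite gaussS gauss_sym //.
have -> : ((n - k.+1).+1 = n - k)%N by lia.
by rewrite gauss_sym // ltnW.
Qed.

Lemma gauss_vandermonde m n k :
  gauss (m + n) k =
  \sum_(t < k.+1) 'X^((m - t) * (k - t)) * gauss m t * gauss n (k - t).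
Proof.
elim: m k => [|m IH] k.
  rewrite big_ord_recl big1 ?addr0 => [|t _].
    by rewrite gauss_n0 !subn0 !mul1r add0n.
  by rewrite /bump /= mulr0 mul0r.
case: k => [|k]; first by rewrite big_ord1 !gauss_n0 muln0 !mul1r.
rewrite addSn gaussS !IH !(big_ord_recl k.+1).
rewrite [in RHS](eq_bigr (fun t : 'I_k.+1 =>
    'X^((m - t) * (k - t)) * gauss m t * gauss n (k - t) +
    'X^(k.+1) * ('X^((m - t.+1) * (k - t)) * gauss m t.+1 * gauss n (k - t)))).
  rewrite big_split /= -mulr_sumr !subn0 !gauss_n0 mulrDr.
  have -> : (m.+1 * k.+1 = k.+1 + m * k.+1)%N by lia.
  by rewrite exprD; rewrite -!mulrA !mul1r addrCA.
move=> t _; rewrite lift0 gaussS !subSS.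
have lt_tk := ltn_ord t.
case: (ltnP t m) => [lt_tm|le_mt]; last by rewrite (gauss_small m t.+1) //; ring.
(* The exponents agree because (m-t)(k-t) + t+1 = k+1 + (m-t-1)(k-t). *)
have -> : 'X^((m - t) * (k - t)) * (gauss m t + 'X^(t.+1) * gauss m t.+1) =
  'X^((m - t) * (k - t)) * gauss m t +
  'X^(k.+1) * ('X^((m - t.+1) * (k - t)) * gauss m t.+1).
  rewrite mulrDr !mulrA -!exprD; congr (_ + 'X^_ * _).
  move: (nat_of_ord t) lt_tk lt_tm => {}t lt_tk lt_tm.
  have [u ->] : exists u, m = (t + u.+1)%N by exists (m - t.+1)%N; lia.
  have [v ->] : exists v, k = (t + v)%N by exists (k - t)%N; lia.
  have -> : (t + u.+1 - t = u.+1)%N by lia.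
  have -> : (t + v - t = v)%N by lia.
  have -> : (t + u.+1 - t.+1 = u)%N by lia.
  by lia.
by ring.
Qed.

(** If i + u <= L, both sides are the q-multinomial coefficient with parts t, i-t, u, L-i-u;
    otherwise both vanish. *)
Lemma gauss_mul_multinomial L i t u : (t <= i)%N ->
  gauss L i * (gauss i t * gauss (L - i) u) =
  gauss L (i - t + u) * gauss (L - (i - t + u)) t * gauss (i - t + u) (i - t).
Proof.
move=> le_ti; case: (leqP (i + u) L) => le_L; last first.
  case: (leqP i L) => leiL; last first.
    rewrite gauss_small // mul0r.
    case: (leqP (i - t + u) L) => leL; last by rewrite gauss_small // !mul0r.
    by rewrite (gauss_small (L - _)%N) ?mulr0 ?mul0r //; lia.
  rewrite (gauss_small (L - i)%N) ?mulr0; last by lia.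
  case: (leqP (i - t + u) L) => leL; last by rewrite gauss_small // !mul0r.
  by rewrite (gauss_small (L - _)%N) ?mulr0 ?mul0r //; lia.
have [v Ev] : exists v, i = (t + v)%N by exists (i - t)%N; lia.
have [w Ew] : exists w, L = (t + v + u + w)%N by exists (L - i - u)%N; lia.
have G x y : gauss (x + y) x * (qpoch x * qpoch y) = qpoch (x + y).
  by rewrite -(gauss_qpoch (x + y) x) ?leq_addr // addKn.
have -> : (i - t = v)%N by lia.
have -> : (L - i = u + w)%N by lia.
have -> : (L - (v + u) = t + w)%N by lia.
rewrite Ev.
have e1 := G (t + v)%N (u + w)%N; have e2 := G t v; have e3 := G u w.
have e4 := G (v + u)%N (t + w)%N; have e5 := G t w; have e6 := G v u.
have E1 : (t + v + (u + w) = L)%N by lia.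
have E2 : (v + u + (t + w) = L)%N by lia.
rewrite E1 in e1; rewrite E2 in e4.
apply: (@mulIf _ (qpoch t * qpoch v * (qpoch u * qpoch w))).
  by rewrite !mulf_neq0 ?qpoch_neq0.
transitivity (qpoch L).
  by rewrite -[RHS]e1 -[in RHS]e2 -[in RHS]e3; ring.
by rewrite -[LHS]e4 -[in LHS]e5 -[in LHS]e6; ring.
Qed.

(** Expand [gauss L l] by q-Vandermonde along L = i + (L - i), then regroup each term as a
    multinomial. *)
Lemma gauss_mul L i l :
  gauss L i * gauss L l = \sum_(t < i.+1 | (t <= l)%N)
    'X^((i - t) * (l - t)) * gauss L (i + l - t.*2) *
    gauss (L - (i + l - t.*2)) t * gauss (i + l - t.*2) (i - t).
Proof.
case: (leqP i L) => leiL; last first.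
  rewrite gauss_small // mul0r big1 // => t ht.
  have lti := ltn_ord t.
  case: (leqP (i + l - t.*2) L) => leL; last by rewrite (gauss_small L) // mulr0 !mul0r.
  by rewrite (gauss_small (L - _)%N) ?mulr0 ?mul0r //; lia.
rewrite -[in gauss L l](subnKC leiL) gauss_vandermonde mulr_sumr.
transitivity (\sum_(0 <= t < l.+1 | (t <= i)%N)
  'X^((i - t) * (l - t)) * gauss L (i + l - t.*2) *
    gauss (L - (i + l - t.*2)) t * gauss (i + l - t.*2) (i - t)); last first.
  rewrite -(big_mkord (fun t => t <= l)%N (fun t =>
    'X^((i - t) * (l - t)) * gauss L (i + l - t.*2) *
    gauss (L - (i + l - t.*2)) t * gauss (i + l - t.*2) (i - t))).
  rewrite [LHS](big_nat_widen _ _ (maxn i l).+1) ?ltnS ?leq_maxr //.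
  rewrite [RHS](big_nat_widen _ _ (maxn i l).+1) ?ltnS ?leq_maxl //.
  by apply: eq_bigl => t; rewrite !ltnS andbC.
rewrite big_mkord [RHS]big_mkcond /=; apply: eq_bigr => t _.
have ltl := ltn_ord t; case: leqP => lei; last first.
  by rewrite (gauss_small i t) // mulr0 !mul0r mulr0.
have -> : (i + l - t.*2 = i - t + (l - t))%N by lia.
set X := 'X^_.
transitivity (X * (gauss L i * (gauss i t * gauss (L - i) (l - t)))); first by ring.
by rewrite gauss_mul_multinomial // !mulrA.
Qed.

(** * The kernels and the transforms they induce *)

Lemma sum_triangle (V : nmodType) (n : nat) (F : nat -> nat -> V) :
  \sum_(i < n) \sum_(t < i.+1) F (i - t)%N t = \sum_(i < n) \sum_(t < n - i) F i t.
Proof.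
elim: n => [|n IH]; first by rewrite !big_ord0.
rewrite big_ord_recr /= IH.
rewrite [RHS](eq_bigr (fun i : 'I_n.+1 => \sum_(t < n - i) F i t + F i (n - i)%N)).
  rewrite big_split /= [in RHS]big_ord_recr /= subnn big_ord0 addr0; congr (_ + _).
  rewrite (reindex_inj rev_ord_inj) /=; apply: eq_bigr => i _.
  by rewrite subSS subKn // -ltnS.
by move=> i _; rewrite (subSn (ltn_ord i : (i <= n)%N)) big_ord_recr.
Qed.

Lemma sum_arith_progression (V : nmodType) (L x : nat) (f : nat -> V) :
  (forall m, (m < x)%N -> odd m == odd x -> f m = 0) -> (forall m, (L < m)%N -> f m = 0) ->
  \sum_(m < L.+1 | odd m == odd x) f m = \sum_(i < L.+1) f (i.*2 + x)%N.
Proof.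
move=> f_lo f_hi.
transitivity (\sum_(m < L.+1 | odd m == odd x) \sum_(i < L.+1)
    (if (m : nat) == (i.*2 + x)%N then f m else 0)).
  apply: eq_bigr => m Pm; case: (ltnP m x) => lxm.
    by rewrite f_lo // big1 // => i _; case: ifP.
  have lt_i : ((m - x)./2 < L.+1)%N by have := ltn_ord m; lia.
  rewrite (bigD1 (Ordinal lt_i)) //= ifT; last by lia.
  rewrite big1 ?addr0 // => i; rewrite -val_eqE /= => ne_i; rewrite ifF //; lia.
rewrite exchange_big /=; apply: eq_bigr => i _.
case: (ltnP L (i.*2 + x)) => lt_L.
  by rewrite f_hi // big1 // => m _; rewrite ifF //; have := ltn_ord m; lia.
have lt_m : (i.*2 + x < L.+1)%N by lia.
rewrite (bigD1 (Ordinal lt_m)) /=; last by lia.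
rewrite eqxx big1 ?addr0 // => m /andP[_]; rewrite -val_eqE /= => ne_m.
by rewrite ifF //; lia.
Qed.

(** This is T_c(L,m). It is independent of x, so one kernel serves all terms of a family at once. *)
Definition kernel (c L m : nat) : {poly rat} := \sum_(t < L.+1)
  'X^((m * (m + c))./2 + t * (t + m + c)) * gauss L m * gauss (L - m) t.

(** Linearize each product by [gauss_mul] and collect the terms with m = 2(i-t) + x; the sum over t
    left at fixed m is the kernel. *)
Lemma kernel_transform (c L x : nat) :
  'X^((x * (x + c))./2) *
    (\sum_(i < L.+1) 'X^(i * (i + x + c)) * (gauss L i * gauss L (i + x))) =
  \sum_(m < L.+1 | odd m == odd x) kernel c L m * gauss m ((m + x)./2).
Proof.
rewrite (@sum_arith_progression _ L x (fun m => kernel c L m * gauss m ((m + x)./2))).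
- pose F (i t : nat) : {poly rat} :=
    'X^(((i.*2 + x) * (i.*2 + x + c))./2) * 'X^(t * (t + (i.*2 + x) + c)) *
    gauss L (i.*2 + x) * gauss (L - (i.*2 + x)) t * gauss (i.*2 + x) i.
  transitivity (\sum_(i < L.+1) \sum_(t < i.+1) F (i - t)%N t).
    rewrite mulr_sumr; apply: eq_bigr => i _.
    rewrite gauss_mul !mulr_sumr big_mkcond; apply: eq_bigr => t _ /=.
    have := ltn_ord t; rewrite ltnS; move: (nat_of_ord i) (nat_of_ord t) => {}i {}t le_ti.
    rewrite ifT; last by lia.
    have [u ->] : exists u, i = (t + u)%N by exists (i - t)%N; lia.
    rewrite /F; have -> : (t + u - t = u)%N by lia.
    have -> : (t + u + (t + u + x) - t.*2 = u.*2 + x)%N by lia.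
    rewrite !mulrA -!exprD; congr ('X^_ * _ * _ * _).
    have -> : ((u.*2 + x) * (u.*2 + x + c) =
      (u * (u + x)).*2.*2 + (u * c).*2 + x * (x + c))%N by lia.
    have -> : (t + u + x - t = u + x)%N by lia.
    have -> : (((u * (u + x)).*2.*2 + (u * c).*2 + x * (x + c))./2 =
      (u * (u + x)).*2 + u * c + (x * (x + c))./2)%N by lia.
    by lia.
  rewrite sum_triangle; apply: eq_bigr => i _.
  rewrite /kernel mulr_suml.
  have -> : ((i.*2 + x + x)./2 = i + x)%N by lia.
  have -> : gauss (i.*2 + x) (i + x) = gauss (i.*2 + x) i.
    rewrite -gauss_sym; last by lia.
    by congr (gauss _ _); lia.
  rewrite (big_ord_widen_cond L.+1 xpredT (F i)) ?leq_subr //.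
  rewrite [LHS]big_mkcond; apply: eq_bigr => t _ /=; rewrite /F exprD.
  case: ltnP => // le_t; case: (leqP (i.*2 + x) L) => leL.
    by rewrite (gauss_small (L - _)%N) ?mulr0 ?mul0r //; lia.
  by rewrite (gauss_small L) // mulr0 !mul0r.
- move=> m lt_mx Pm; rewrite gauss_small ?mulr0 //; lia.
- by move=> m lt_Lm; rewrite /kernel big1 ?mul0r // => t _; rewrite gauss_small // mulr0 mul0r.
Qed.

Lemma gauss_vandermonde_central (m n x : nat) :
  gauss (m + n) (m + x) =
  \sum_(i < m.+1) 'X^(i * (i + x)) * (gauss m i * gauss n (i + x)).
Proof.
rewrite gauss_vandermonde -(big_mkord xpredT
  (fun t => 'X^((m - t) * (m + x - t)) * gauss m t * gauss n (m + x - t))).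
rewrite (big_cat_nat (n := m.+1)) ?ltnS ?leq_addr //= [X in _ + X]big_nat_cond.
rewrite [X in _ + X]big1 ?addr0; last first.
  by move=> t /andP[/andP[lt_mt _] _]; rewrite (gauss_small m) // mulr0 mul0r.
rewrite big_mkord (reindex_inj rev_ord_inj) /=; apply: eq_bigr => i _.
have le_im : (i <= m)%N by rewrite -ltnS.
rewrite subSS gauss_sym // mulrA.
have -> : (m - (m - i) = i)%N by lia.
by have -> : (m + x - (m - i) = i + x)%N by lia.
Qed.

Lemma gauss_even_transform (L x : nat) :
  'X^((x * x)./2) * gauss (L + L) (L + x) =
  \sum_(m < L.+1 | odd m == odd x) kernel 0 L m * gauss m ((m + x)./2).
Proof.
rewrite -kernel_transform gauss_vandermonde_central addn0.
by congr (_ * _); apply: eq_bigr => i _; rewrite addn0.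
Qed.

(** Splitting [gauss L.+1 i] by q-Pascal gives the c = 1 sums for x = b and x = b+1. They supply the
    m of the two parities, and the rounding in (m+b+1)/2 covers both. *)
Lemma gauss_odd_transform (L b : nat) :
  'X^((b * b.+1)./2) * gauss (L.+1 + L) (L.+1 + b) =
  \sum_(m < L.+1) kernel 1 L m * gauss m ((m + b).+1./2).
Proof.
have -> : gauss (L.+1 + L) (L.+1 + b) =
    \sum_(i < L.+1) 'X^(i * (i + b + 1)) * (gauss L i * gauss L (i + b)) +
    'X^(b.+1) * \sum_(i < L.+1) 'X^(i * (i + b.+1 + 1)) * (gauss L i * gauss L (i + b.+1)).
  have -> : \sum_(i < L.+1) 'X^(i * (i + b + 1)) * (gauss L i * gauss L (i + b)) =
      \sum_(i < L.+2) 'X^(i * (i + b + 1)) * (gauss L i * gauss L (i + b)).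
    by rewrite [RHS]big_ord_recr /= (gauss_small L L.+1) // mul0r mulr0 addr0.
  rewrite gauss_vandermonde_central !(big_ord_recl L.+1) -addrA; congr (_ + _).
    by rewrite !gauss_n0.
  rewrite mulr_sumr -big_split; apply: eq_bigr => i _.
  rewrite lift0 gaussS mulrDl mulrDr addrC !mulrA -!exprD.
  by congr ('X^_ * _ * gauss _ _ + 'X^_ * _ * gauss _ _); lia.
rewrite mulrDr mulrA -exprD.
have -> : (b * b.+1)./2 = (b * (b + 1))./2 by rewrite addn1.
rewrite kernel_transform.
have -> : ((b * (b + 1))./2 + b.+1 = (b.+1 * (b.+1 + 1))./2)%N by lia.
rewrite kernel_transform [RHS](bigID (fun m : 'I_L.+1 => odd m == odd b)) /=.
congr (_ + _); first by apply: eq_bigr => m Pm; congr (_ * gauss _ _); lia.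
apply: eq_big => m; first by case: (odd m); rewrite /=; case: (odd b).
by move=> Pm; congr (_ * gauss _ _); lia.
Qed.

(** * Coefficients and lower indices ranging over the integers *)

(* Coefficient extraction at an integer index, so that q^e * P with e negative is
   handled as icoef P (x - e). *)
Definition icoef (P : {poly rat}) (x : int) : rat :=
  if x is Posz k then P`_k else 0.

Lemma icoef0 x : icoef 0 x = 0.
Proof. by case: x => k //=; rewrite coef0. Qed.

Lemma icoefD P Q x : icoef (P + Q) x = icoef P x + icoef Q x.
Proof. by case: x => k /=; rewrite ?coefD ?addr0. Qed.

Lemma icoef_sum (I : Type) (r : seq I) (C : pred I) (F : I -> {poly rat}) x :
  icoef (\sum_(i <- r | C i) F i) x = \sum_(i <- r | C i) icoef (F i) x.
Proof.
by apply: (big_morph (icoef^~ x)) => [P Q|]; rewrite ?icoefD ?icoef0.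
Qed.

Lemma icoefZ a P x : icoef (a *: P) x = a * icoef P x.
Proof. by case: x => k /=; rewrite ?coefZ ?mulr0. Qed.

Lemma icoefXnM k P x : icoef ('X^k * P) x = icoef P (x - k%:Z).
Proof.
case: x => [m|m]; last first.
  by have -> : Negz m - k%:Z = Negz (m + k) by lia.
rewrite /= coefXnM; case: ltnP => [lt_mk|le_km].
  by have -> : m%:Z - k%:Z = Negz (k - m).-1 by lia.
by rewrite subzn.
Qed.

Lemma icoefM T P x :
  icoef (T * P) x = \sum_(k < size T) T`_k * icoef P (x - k%:Z).
Proof.
rewrite -{1}[T]coefK poly_def mulr_suml icoef_sum; apply: eq_bigr => k _.
by rewrite -scalerAl icoefZ icoefXnM.
Qed.

Definition gaussz (n : nat) (k : int) : {poly rat} :=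
  if k is Posz m then gauss n m else 0.

Lemma gaussz_out n (k : int) : (k < 0) || (n%:Z < k) -> gaussz n k = 0.
Proof. by case: k => k //= H; apply: gauss_small; lia. Qed.

Lemma gaussz_sym n (k : int) : gaussz n (n%:Z - k) = gaussz n k.
Proof.
case: (boolP ((k < 0) || (n%:Z < k))) => Hk.
  by rewrite !gaussz_out //; lia.
case: k Hk => k Hk //; rewrite subzn /=; last by lia.
by rewrite gauss_sym //; lia.
Qed.

(** Stated on coefficients because q^k is not a polynomial for k < 0; this way q-Pascal holds for
    every integer k. *)
Lemma icoef_gausszS n (k x : int) :
  icoef (gaussz n.+1 k) x = icoef (gaussz n (k - 1)) x + icoef (gaussz n k) (x - k).
Proof.
case: k => [[|k]|k].
- by rewrite /= !gauss_n0 subr0 icoef0 add0r.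
- have -> : k.+1%:Z - 1 = k by lia.
  by rewrite /= icoefD icoefXnM.
- have -> : Negz k - 1 = Negz k.+1 by lia.
  by rewrite /= !icoef0 addr0.
Qed.

Lemma icoef_gausszS_dual n (k x : int) :
  icoef (gaussz n.+1 k) x =
  icoef (gaussz n k) x + icoef (gaussz n (k - 1)) (x - (n.+1%:Z - k)).
Proof.
case: (boolP ((k < 0) || (n.+1%:Z < k))) => Hk.
  by rewrite !gaussz_out ?icoef0 ?addr0 //; lia.
case: k Hk => [[|k]|k] // Hk.
- by rewrite /= !gauss_n0 icoef0 addr0.
- have le_kn : (k <= n)%N by lia.
  have -> : k.+1%:Z - 1 = k by lia.
  rewrite /gaussz gaussS_dual // icoefD icoefXnM.
  by congr (_ + icoef _ _); lia.
Qed.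

(** * Positivity of the initial polynomials *)

(** The coefficient of q^d in D_{K,i}(n-M, M; p-b, b), cut off at |j| <= B. The sum p of the last
    two parameters stays fixed in the recurrences below. *)
Definition hookD (B : nat) (K p i : int) (n : nat) (M b d : int) : rat :=
  \sum_(t < (B + B).+1)
    let j : int := t%:Z - B%:Z in
    (icoef (gaussz n (M - K * j)) (d - j * (p * K * j + K * b - p * i))
     - icoef (gaussz n (M - K * j - i)) (d - (p * j + b) * (K * j + i))).

Section HookDifferences.
Variables (B : nat) (K p i : int).
Local Notation D := (hookD B K p i).

(** Dual q-Pascal in every term: the j-dependent part of the extra power of q is exactly the effect
    of b -> b+1. *)
Lemma hookD_rec n M b d :
  D n.+1 M b d = D n M b d + D n (M - 1) (b + 1) (d - (n.+1%:Z - M)).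
Proof.
rewrite /hookD -big_split /=; apply: eq_bigr => t _.
move: (t%:Z - B%:Z) => j.
rewrite !icoef_gausszS_dual.
have subrDD (u v y z : rat) : u + v - (y + z) = u - y + (v - z) by ring.
rewrite subrDD.
congr (_ - _ + (icoef (gaussz _ _) _ - icoef (gaussz _ _) _)); ring.
Qed.

Lemma hookD_rec_dual n M b d :
  D n.+1 M b d = D n (M - 1) b d + D n M (b - 1) (d - M).
Proof.
rewrite /hookD -big_split /=; apply: eq_bigr => t _.
move: (t%:Z - B%:Z) => j.
rewrite !icoef_gausszS.
have subrDD (u v y z : rat) : u + v - (y + z) = u - y + (v - z) by ring.
rewrite subrDD.
congr (icoef (gaussz _ _) _ - icoef (gaussz _ _) _ +
  (icoef (gaussz _ _) _ - icoef (gaussz _ _) _)); ring.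
Qed.

(* The substitution j -> -j exchanges the two families of terms. *)
Lemma hookD_lower n M d : n%:Z - 2 * M + i = 0 -> D n M 0 d = 0.
Proof.
move=> Hh; rewrite /hookD sumrB; apply/eqP; rewrite subr_eq0; apply/eqP.
rewrite (reindex_inj rev_ord_inj) /=; apply: eq_bigr => t _.
have -> : ((B + B).+1 - t.+1)%N%:Z - B%:Z = - (t%:Z - B%:Z) :> int.
  by have := ltn_ord t; lia.
move: (t%:Z - B%:Z) => j; rewrite -gaussz_sym; congr (icoef (gaussz _ _) _); last by ring.
have -> : n%:Z = 2 * M - i by lia.
by ring.
Qed.

(* The substitution j -> -j-1 exchanges the two families, up to boundary terms
   that vanish since n < 2B. *)
Lemma hookD_upper n M d : 0 < i -> i < K -> (n < B.*2)%N ->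
  n%:Z - 2 * M + i = K -> D n M p d = 0.
Proof.
move=> i_gt0 lt_iK lt_nB Hh; rewrite /hookD sumrB.
apply/eqP; rewrite subr_eq0; apply/eqP.
(* This gives 2KB >= K + 2B - 1, whence M - KB < 0: the j = B terms, which have no partner under j
   -> -j-1, vanish. *)
have HK : 0 <= (K - 1) * (2 * B%:Z - 1) by rewrite mulr_ge0 //; lia.
rewrite big_ord_recr [RHS]big_ord_recr /=.
have -> : icoef (gaussz n (M - K * ((B + B)%N%:Z - B%:Z)))
   (d - ((B + B)%N%:Z - B%:Z) * (p * K * ((B + B)%N%:Z - B%:Z) + K * p - p * i)) = 0.
  by rewrite gaussz_out ?icoef0 //; lia.
have -> : icoef (gaussz n (M - K * ((B + B)%N%:Z - B%:Z) - i))
   (d - (p * ((B + B)%N%:Z - B%:Z) + p) * (K * ((B + B)%N%:Z - B%:Z) + i)) = 0.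
  by rewrite gaussz_out ?icoef0 //; lia.
congr (_ + _); rewrite (reindex_inj rev_ord_inj) /=; apply: eq_bigr => t _.
have -> : (B + B - t.+1)%N%:Z - B%:Z = - (t%:Z - B%:Z) - 1 :> int.
  by have := ltn_ord t; lia.
move: (t%:Z - B%:Z) => j; rewrite -gaussz_sym; congr (icoef (gaussz _ _) _); last by ring.
have -> : n%:Z = 2 * M - i + K by lia.
by ring.
Qed.

Lemma gauss_ge0 n k m : 0 <= (gauss n k)`_m.
Proof.
elim: n k m => [|n IH] [|k] m /=; rewrite ?coef1 ?coef0 ?ler0n //.
by rewrite coefD coefXnM addr_ge0 ?IH //; case: ifP.
Qed.

Lemma icoef_gaussz_ge0 n k x : 0 <= icoef (gaussz n k) x.
Proof. by case: x => // x; case: k => [k|k] /=; rewrite ?gauss_ge0 ?coef0. Qed.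

(* With N = n - M and h = N - M + i - b, one of the two recurrences stays in the
   region 0 <= b <= p, 0 <= h <= K - p, except at (b, h) = (0, 0) and (p, K - p),
   where D vanishes. *)
Lemma hookD_ge0 n M b d : 0 < i -> i < K -> 0 < p -> p < K -> (n < B.*2)%N ->
  0 <= b -> b <= p -> 0 <= n%:Z - 2 * M + i - b -> n%:Z - 2 * M + i - b <= K - p ->
  0 <= D n M b d.
Proof.
move=> i_gt0 lt_iK p_gt0 lt_pK; elim: n M b d => [|n IH] M b d lt_nB b_ge0 le_bp h_ge0 h_le.
  apply: sumr_ge0 => t _ /=; move: (t%:Z - B%:Z) => j.
  rewrite (gaussz_out 0 (M - K * j - i)) ?icoef0 ?subr0 ?icoef_gaussz_ge0 //.
  suff : M - K * j - i <> 0 by lia.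
  (* With h = -2M + i - b one has 0 < b + h + i < 2K, which would force -1 < j < 0. *)
  move=> HM; have E : 2 * (K * j) = - (b + (0%N%:Z - 2 * M + i - b) + i) by lia.
  have : -1 < j by nia.
  by nia.
case: (boolP ((n.+1%:Z - 2 * M + i - b != 0) && (b != p))) => [H1|H1].
  by rewrite hookD_rec addr_ge0 ?IH //; lia.
case: (boolP ((n.+1%:Z - 2 * M + i - b != K - p) && (b != 0))) => [H2|H2].
  by rewrite hookD_rec_dual addr_ge0 ?IH //; lia.
have [b0|bp] : b = 0 \/ b = p by lia.
  by rewrite b0 hookD_lower //; lia.
by rewrite bp hookD_upper //; lia.
Qed.
End HookDifferences.

(** * Propagation of positivity through the levels *)

Lemma kernel_ge0 c L m k : 0 <= (kernel c L m)`_k.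
Proof.
rewrite /kernel coef_sum; apply: sumr_ge0 => t _; rewrite -mulrA coefXnM.
by case: ifP => // _; rewrite coefM sumr_ge0 // => u _; rewrite mulr_ge0 ?gauss_ge0.
Qed.

Lemma triangular_double x : ((x * x.+1)./2).*2 = (x * x.+1)%N.
Proof. by rewrite -[RHS]odd_double_half oddM oddS andbN. Qed.

Section PositiveFamilies.
Variables (I : finType) (c : I -> rat) (e : I -> int).

(** Non-negativity of the sum of c_k q^(e_k) P_k. The weights c and e stay fixed from level to
    level; only the polynomials change. *)
Definition posfam (P : I -> {poly rat}) : Prop :=
  forall d : int, 0 <= \sum_k c k * icoef (P k) (d - e k).

Lemma eq_posfam P Q : P =1 Q -> posfam P -> posfam Q.
Proof. by move=> eqPQ H d; under eq_bigr do rewrite -eqPQ. Qed.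

Lemma posfamM (T : {poly rat}) P :
  (forall k, 0 <= T`_k) -> posfam P -> posfam (fun k => T * P k).
Proof.
move=> T_ge0 P_pos d.
under eq_bigr do rewrite icoefM mulr_sumr.
rewrite exchange_big sumr_ge0 // => k _.
have := mulr_ge0 (T_ge0 k) (P_pos (d - k%:Z)); rewrite mulr_sumr.
by under eq_bigr do rewrite mulrCA addrAC.
Qed.

Lemma posfam_sum (J : finType) (A : pred J) (P : J -> I -> {poly rat}) :
  (forall m, A m -> posfam (P m)) -> posfam (fun k => \sum_(m | A m) P m k).
Proof.
move=> P_pos d; under eq_bigr do rewrite icoef_sum mulr_sumr.
by rewrite exchange_big sumr_ge0 // => m Am; apply: P_pos.
Qed.

Variables (b : I -> nat) (B : nat).
(** The bound on m reflects the cut-off in [hookD]; it persists at higher levels since the kernels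
    only involve m <= L. *)
Hypothesis level0 : forall m, (m < B)%N -> posfam (fun k => gauss m ((m + b k).+1./2)).

Let tri (x : nat) := ((x * x.+1)./2)%N.

Lemma posfam_level1 L : (L < B)%N ->
  posfam (fun k => 'X^(tri (b k)) * gauss (L.+1 + L) (L.+1 + b k)).
Proof.
move=> ltLB; apply: (@eq_posfam (fun k =>
    \sum_(m < L.+1) kernel 1 L m * gauss m ((m + b k).+1./2))).
  by move=> k; rewrite gauss_odd_transform.
apply: posfam_sum => m _; apply: posfamM; first exact: kernel_ge0.
by apply: level0; have := ltn_ord m; lia.
Qed.

(** Even transform at x = 2b+1: only odd m = 2m'+1 occur, and (m+x)/2 = m'+1+b is the index of level
    1. The exponent floor(x^2/2) = 4 [tri] b raises 1 to 5. *)
Lemma posfam_level2 L : (L < B)%N ->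
  posfam (fun k => 'X^(5 * tri (b k)) * gauss (L + L) (L + (b k).*2.+1)).
Proof.
move=> ltLB; apply: (@eq_posfam (fun k => \sum_(m < L.+1 | odd m)
    kernel 0 L m * ('X^(tri (b k)) * gauss (m./2.+1 + m./2) (m./2.+1 + b k)))).
  move=> k; have -> : (5 * tri (b k) = tri (b k) + ((b k).*2.+1 * (b k).*2.+1)./2)%N.
    by have := triangular_double (b k); rewrite /tri; lia.
  rewrite exprD -mulrA gauss_even_transform mulr_sumr; apply: eq_big => m.
    by rewrite /= odd_double; case: odd.
  move=> odd_m; rewrite mulrCA; congr (_ * (_ * gauss _ _)); lia.
apply: posfam_sum => m _; apply: posfamM; first exact: kernel_ge0.
by apply: posfam_level1; have := ltn_ord m; lia.
Qed.

(** Level n+2 of the induction, with g = (4^(n+2) - 1)/3. The constant [C] is a common power of q,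
    so its value is irrelevant to positivity. *)
Lemma posfam_level n g : (3 * g + 1 = 4 ^ n.+2)%N ->
  exists C : nat, forall L, (L < B)%N ->
  posfam (fun k => 'X^(g * tri (b k) + C) * gauss (L + L) (L + 2 ^ n * (b k).*2.+1)).
Proof.
elim: n g => [|n IH] g Eg.
  have -> : (g = 5)%N by lia.
  exists 0%N => L ltLB; apply: eq_posfam (posfam_level2 L ltLB) => k.
  by rewrite addn0 expn0 mul1n.
have [h Eh] : exists h, (3 * h + 1 = 4 ^ n.+2)%N.
  by move: Eg; rewrite expnS; exists (g %/ 4)%N; lia.
have [C HC] := IH h Eh.
(* For x = 2^(n+1) (2b+1), x^2/2 = 4^(n+2) [tri] b + 2 * 4^n: the first part turns h into g, the
   second adds to [C]. *)
exists (C + 2 * 4 ^ n)%N => L ltLB.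
apply: (@eq_posfam (fun k => \sum_(m < L.+1 | ~~ odd m) kernel 0 L m *
    ('X^(h * tri (b k) + C) * gauss (m./2 + m./2) (m./2 + 2 ^ n * (b k).*2.+1)))).
  move=> k; set x := (2 ^ n.+1 * _)%N.
  have -> : (g * tri (b k) + (C + 2 * 4 ^ n) = h * tri (b k) + C + (x * x)./2)%N.
    have -> : (x * x = 4 ^ n.+1 * (8 * tri (b k) + 1))%N.
      have -> : (8 * tri (b k) + 1 = (b k).*2.+1 * (b k).*2.+1)%N.
        by have := triangular_double (b k); rewrite /tri; lia.
      by rewrite (expnMn 2 2 n.+1) /x; lia.
    have -> : (g = h + 4 ^ n.+2)%N by move: Eg; rewrite expnS; lia.
    by rewrite !expnS; lia.
  have even_x : odd x = false by rewrite /x oddM oddX.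
  rewrite [in RHS]exprD -mulrA gauss_even_transform mulr_sumr even_x; apply: eq_big => m.
    by case: odd.
  move=> odd_m; rewrite mulrCA; congr (_ * (_ * gauss _ _)); rewrite /x ?expnS; lia.
apply: posfam_sum => m _; apply: posfamM; first exact: kernel_ge0.
by apply: HC; have := ltn_ord m; lia.
Qed.
End PositiveFamilies.

(** * Identification with the coefficients of D *)

(* Identifies a with -a-1. *)
Definition fold (a : int) : nat := match a with Posz m => m | Negz m => m end.

Lemma fold_tri a : 2 * ((fold a * (fold a).+1)./2)%N%:Z = a * (a + 1).
Proof.
have -> : a * (a + 1) = (fold a * (fold a).+1)%N%:Z by case: a => m /=; lia.
by rewrite -triangular_double; lia.
Qed.

(** Replacing a by -a-1 amounts to k -> m - k, up to the parity bit h that the rounding absorbs. *)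
Lemma gaussz_fold m (a k h : int) : 2 * k = m%:Z - a - h -> 0 <= h <= 1 ->
  gaussz m k = gauss m ((m + fold a).+1./2).
Proof.
case: a => a Ek Hh /=.
  rewrite -gaussz_sym.
  by have -> : m%:Z - k = ((m + a).+1./2)%:Z by lia.
by have -> : k = ((m + a).+1./2)%:Z by lia.
Qed.

(** The factor 2a+1 changes sign under a -> -a-1, which is the symmetry about the centre L. *)
Lemma gaussz_fold_even L x a :
  gaussz (L + L) (L%:Z - x%:Z * (2 * a + 1)) = gauss (L + L) (L + x * (fold a).*2.+1).
Proof.
case: a => a /=.
  rewrite -gaussz_sym.
  by have -> : (L + L)%N%:Z - (L%:Z - x%:Z * (2 * a%:Z + 1)) = (L + x * a.*2.+1)%N by lia.
by have -> : L%:Z - x%:Z * (2 * Negz a + 1) = (L + x * a.*2.+1)%N by lia.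
Qed.

Lemma qbinomE (n : nat) (k : int) : qbinom n k = gaussz n k.
Proof.
rewrite /qbinom; case: ifP => [/andP[]|] Hk; last first.
  by rewrite gaussz_out //; lia.
case: k Hk => k // _ le_kn; rewrite subzn // !absz_nat /= -(@gauss_qpoch n k) //.
by rewrite mulpK // mulf_neq0 ?qpoch_neq0.
Qed.

Lemma shift_coef_int (e d : int) P :
  shift_coef e%:~R P d%:~R = icoef P (d - e).
Proof.
rewrite /shift_coef -intrB denq_int numq_int eqxx /=.
by case: (d - e).
Qed.

Lemma shift_coef_nonint (e : int) P (d : rat) :
  denq d != 1 -> shift_coef e%:~R P d = 0.
Proof.
move=> Hd; rewrite /shift_coef ifF //; apply/negbTE; apply: contra Hd => /andP[/eqP H _].
have := divq_num_den (d - e%:~R); rewrite H divr1; move: (numq _) => z Ez.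
have -> : d = (z + e)%:~R by rewrite intrD Ez subrK.
by rewrite denq_int.
Qed.

Theorem theorem2p3 (L : nat) (p p' : int) (n : nat) (r s : int) :
  0 < p -> p < p' -> (2 <= n)%N ->
  0 < r -> r < p -> 0 < s -> s < p' ->
  Dnonneg ((2 ^ n)%N%:Z * p') ((2 ^ n)%N%:Z * s)
    (L%:Z + (2 ^ (n - 2))%N%:Z + (2 ^ (n - 1))%N%:Z * (r - s))
    (L%:Z - (2 ^ (n - 2))%N%:Z - (2 ^ (n - 1))%N%:Z * (r - s))
    ((((2 ^ (2 * n))%N%:R - 1) / 3 * (2 * p'%:~R - 1)
       - ((2 ^ (2 * n + 1))%N%:R + 1) / 3 * r%:~R + p%:~R) / (2 ^ n)%N%:R)
    ((((2 ^ (2 * n + 1))%N%:R + 1) / 3 * r%:~R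
       + ((2 ^ (2 * n))%N%:R - 1) / 3) / (2 ^ n)%N%:R).
Proof.
move=> p_gt0 lt_pp'; case: n => [//|[//|n]] _ r_gt0 lt_rp s_gt0 lt_sp'.
have -> : (n.+2 - 2 = n)%N by lia.
have -> : (n.+2 - 1 = n.+1)%N by lia.
(* From here n stands for the original n minus 2; (2^(2n)-1)/3 and (2^(2n+1)+1)/3 of the statement
   become g and 2g+1. *)
have [g Eg] : exists g, (3 * g + 1 = 4 ^ n.+2)%N.
  elim: n => [|n [g Eg]]; first by exists 5%N.
  by exists (g + 4 ^ n.+2)%N; rewrite [in RHS]expnS; lia.
have E2n : (2 ^ (2 * n.+2))%N%:R = 3 * g%:R + 1 :> rat.
  by rewrite expnM -Eg natrD natrM.
have E2n1 : (2 ^ (2 * n.+2 + 1))%N%:R = 6 * g%:R + 2 :> rat.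
  by rewrite addn1 expnS natrM E2n; ring.
rewrite E2n E2n1.
set Q := (2 ^ n.+2)%N; set M := L%:Z - _ - _; set N := L%:Z + _ + _.
have Q_neq0 : Q%:R != 0 :> rat by rewrite pnatr_eq0 /Q; lia.
have EN : M + N = (L + L)%N by rewrite /M /N; lia.
set al := ((_ - _ + _) / Q%:R); set be := (_ / Q%:R).
move=> d; rewrite /Dcoef; set B := Dbound _ _ _ _.
have lt_LB : (L < B.*2)%N by rewrite /B /Dbound; lia.
pose a (u : bool) (t : 'I_((B + B).+1)) : int :=
  2 * p' * (t%:Z - B%:Z) + (if u then r - s else r + s).
pose e0 (u : bool) (t : 'I_((B + B).+1)) : int := let j := t%:Z - B%:Z in
  if u then j * (p * p' * j + p' * r - p * s) else (p * j + r) * (p' * j + s).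
pose T (x : int) : int := ((fold x * (fold x).+1)./2)%N.
have TE x : (T x)%:~R = x%:~R * (x%:~R + 1) / 2 :> rat.
  have := fold_tri x; rewrite -/(T x) => /(congr1 (fun z : int => z%:~R : rat)).
  by rewrite !intrM intrD => <-; field.
(* The exponent splits into the level-independent [e0], g times a triangular number, and a constant
   common to both families. *)
have E1 (t : 'I_((B + B).+1)) : De1 (Q%:Z * p') (Q%:Z * s) al be (t%:Z - B%:Z) =
    (e0 true t + g%:Z * T (a true t) - g%:Z * T (r - s))%:~R.
  rewrite 2!(intrB, intrD) !intrM !TE /De1 /al /be /e0 /a; move: (t%:Z - B%:Z) => j.
  rewrite !(intrD, intrB, intrM, intrN) -!pmulrn.
  by field.
have E2 (t : 'I_((B + B).+1)) : De2 (Q%:Z * p') (Q%:Z * s) al be (t%:Z - B%:Z) =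
    (e0 false t + g%:Z * T (a false t) - g%:Z * T (r - s))%:~R.
  rewrite 2!(intrB, intrD) !intrM !TE /De2 /al /be /e0 /a; move: (t%:Z - B%:Z) => j.
  rewrite !(intrD, intrB, intrM, intrN) -!pmulrn.
  by field.
(* All exponents are integers, so the coefficient at a non-integral d is 0. *)
have [dint|dnint] := eqVneq (denq d) 1; last first.
  by rewrite big1 // => t _; rewrite E1 E2 !shift_coef_nonint ?subrr.
have {dint} [d' ->] : exists d' : int, d = d'%:~R.
  by exists (numq d); rewrite -{1}[d]divq_num_den dint divr1.
pose sg (k : bool * 'I_((B + B).+1)) : rat := if k.1 then 1 else -1.
pose e k := e0 k.1 k.2; pose b k := fold (a k.1 k.2).
have level0 m : (m < B.*2)%N -> posfam _ sg e (fun k => gauss m ((m + b k).+1./2)).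
  move=> lt_mB d0.
  (* Rounding down makes m - 2 [M0] + s - r equal to h in {0, 1}, which lies in the range [0, p'-p]
     required by [hookD_ge0]. *)
  have [M0 [h [EM0 Hh]]] : exists M0 h : int, 2 * M0 = m%:Z - (r - s) - h /\ 0 <= h <= 1.
    by exists ((m%:Z - (r - s)) %/ 2)%Z, ((m%:Z - (r - s)) %% 2)%Z; lia.
  have := @hookD_ge0 B p' p s m M0 r d0 s_gt0 lt_sp' p_gt0 lt_pp' lt_mB.
  move=> /(_ ltac:(lia) ltac:(lia) ltac:(lia) ltac:(lia)).
  congr (0 <= _); rewrite -(pair_bigA _ (fun u t => sg (u, t) *
    icoef (gauss m ((m + b (u, t)).+1./2)) (d0 - e (u, t)))) big_bool -big_split.
  apply: eq_bigr => t _; rewrite /sg /e /e0 /b /a /= mul1r mulN1r.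
  by congr (icoef _ _ - icoef _ _); apply: gaussz_fold Hh; lia.
have [C /(_ L lt_LB) HC] := posfam_level _ _ _ _ _ level0 n g Eg.
(* The index compensates the common powers of q, namely -g T(r-s) in D and [C] in the family. *)
have := HC (d' + g%:Z * T (r - s) + C%:Z); congr (0 <= _).
rewrite -(pair_bigA _ (fun u t => sg (u, t) * icoef
    ('X^(g * (b (u, t) * (b (u, t)).+1)./2 + C) * gauss (L + L) (L + 2 ^ n * (b (u, t)).*2.+1))
    (d' + g%:Z * T (r - s) + C%:Z - e (u, t)))) big_bool -big_split.
apply: eq_bigr => t _; rewrite /= E1 E2 !shift_coef_int EN !qbinomE /sg /e /b /= mul1r mulN1r.
(* The lower indices match since M - 2^(n+2) p'j = L - 2^n (2a+1) for a = 2p'j + r - s, and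
   similarly for r + s. *)
rewrite !icoefXnM -!gaussz_fold_even.
congr (icoef (gaussz _ _) _ - icoef (gaussz _ _) _); rewrite /T /M /Q /a ?expnS; lia.
Qed.
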